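(* Let $\Phi_H=\{\phi_t\}$, $H$ and $h$ be the compactly supported continuous isotopy, continuous Hamiltonian and continuous function on $\mathbb R^{2n+1}$ constructed in the context from the singular profile $\rho$ (equal to $r^{-a}$, $0<a<2$, near $r=0$) and the cut-off function $\eta$. The triple $(\Phi_H,H,h)$ is a continuous contact dynamical system, and therefore also a topological contact dynamical system. In particular, its time-one map $\phi=\phi_1$ is a contact homeomorphism.
   Context: On $\mathbb R^{2n+1}$ use coordinates $(r_1,\dots,r_n,\theta_1,\dots,\theta_n,z)$, where $(r_i,\theta_i)$ are polar coordinates ($x_i=r_i\cos\theta_i$, $y_i=r_i\sin\theta_i$), write $r=\sqrt{r_1^2+\dots+r_n^2}$, and let $\alpha=dz+\frac12\sum_i r_i^2\,d\theta_i$, $\xi=\ker\alpha$. The contact vector field $X_H$ of a Hamiltonian $H$ is determined by $\alpha(X_H)=H$ and $\iota_{X_H}d\alpha=\frac{\partial H}{\partial z}\alpha-dH$; its flow is $\Phi_H=\{\phi_H^t\}$, its conformal factor $h$ is given by $(\phi_H^t)^*\alpha=e^{h_t}\alpha$, and $(\Phi_H,H,h)$ is a smooth contact dynamical system. Construction. Let $0<a<2$. Let $\rho\colon(0,1]\to[0,\infty)$ be smooth, identically zero near $r=1$ and equal to $r^{-a}$ near $r=0$ (extended by $0$ for $r\ge1$). Let $\eta\colon\mathbb R\to[0,1]$ be smooth, compactly supported, with $\eta=1$ near $0$; $\rho$ and $\eta$ are chosen such that for some $u>0$, $\eta\big(z\pm(\frac12r^2\rho(r)+\int_r^1s\rho(s)\,ds)\big)=1$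 for all $|z|\le u$ and all $r\ge0$ (values at $r=0$ are limits as $r\to0^+$, and the integral is $0$ for $r\ge1$). Choose smooth $\rho_j\colon[0,1]\to\mathbb R$, $j\ge1$, with $\rho_j(r)=\rho(r)$ for $r\ge\epsilon_j$, where $\epsilon_j\downarrow0$, and $0\le\rho_j\le\rho_k\le\rho$ for $k\ge j$, such that the compactly supported functions $H_j=\eta(z)\int_r^1s\rho_j(s)\,ds$ (zero for $r\ge1$) are smooth on $\mathbb R^{2n+1}$. Then $H_j$ converges uniformly to the continuous function $H=\eta(z)\int_r^1s\rho(s)\,ds$ (with $\int_0^1=\lim_{r\to0^+}\int_r^1$ at $r=0$), and the flows $\{\phi_{H_j}^t\}$ converge uniformly to a compactly supported continuous isotopy $\{\phi_t\}$ of homeomorphisms of $\mathbb R^{2n+1}$. Write $\Phi_H=\{\phi_t\}$, and define $h_t=\int_0^t\big(\eta'(z)\int_r^1v\rho(v)\,dv\big)\circ\phi_s\,ds$. Definitions (compactly supported case). A compactly supported triple $(\Phi,H,h)$ of a continuous isotopy of homeomorphisms and functions on $[0,1]\times\mathbb R^{2n+1}$ is a continuous contact dynamical system if there are smooth contact dynamical systems $(\Phi_{H_i},H_i,h_i)$, supported in a common compact set, with $\Phi_{H_i}\to\Phi$, $h_i\to h$ and $H_i\to H$ uniformly. It is a topological contact dynamical system if instead of uniform convergence $H_i\to H$ one requires $\int_0^1\|H_t-(H_i)_t\|\,dt\to0$, where for each $t$ the norm is equivalent to the supremum norm on functions supported in the fixed compact set. A contact homeomorphism is the time-one map of a topological contact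 dynamical system. *)

(* Defs.v *)
From mathcomp Require Import all_boot all_order all_algebra.
From mathcomp Require Import all_classical all_reals all_analysis measurable_realfun.

Set Implicit Arguments.
Unset Strict Implicit.
Unset Printing Implicit Defensive.

Import Order.TTheory GRing.Theory Num.Theory.
Import numFieldNormedType.Exports.

Local Open Scope classical_set_scope.
Local Open Scope ring_scope.

Section Smoothness.
Context {R : realType}.

(* [Ck_on U k f] and [smooth_on U f] are meant for an open set [U] of a
   finite-dimensional [V], where "differentiable with all directional
   derivatives of class C^k" is the usual C^(k+1). *)
Fixpoint Ck_on {V W : normedModType R} (U : set V) (k : nat) (f : V -> W) :
    Prop :=
  match k with
  | 0 => forall x, U x -> {for x, continuous f}
  | k'.+1 => (forall x, U x -> differentiable f x) /\
             (forall v : V, Ck_on U k' (fun x => 'D_v f x))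
  end.

Definition smooth_on {V W : normedModType R} (U : set V) (f : V -> W) : Prop :=
  forall k, Ck_on U k f.

(* Smoothness on the closed interval [0, 1]: one-sided at the end points. *)
Definition smooth_on01 (f : R -> R) : Prop :=
  exists g : R -> R,
    smooth_on setT g /\ (forall r : R, 0 <= r <= 1 -> g r = f r).

End Smoothness.

(* R^(2n+1), with Cartesian coordinates ((x, y), z). *)
Notation contact_space R n := ('rV[R]_n * 'rV[R]_n * R)%type.

Section ContactGeometry.
Context {R : realType} {n : nat}.
Local Notation V := (contact_space R n).

Definition xcoord (p : V) (i : 'I_n) : R := p.1.1 0 i.
Definition ycoord (p : V) (i : 'I_n) : R := p.1.2 0 i.
Definition zcoord (p : V) : R := p.2.

Definition rad (p : V) : R :=
  Num.sqrt (\sum_(i < n) (xcoord p i ^+ 2 + ycoord p i ^+ 2)).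

(* alpha = dz + 1/2 sum_i r_i^2 dtheta_i, where
   r_i^2 dtheta_i = x_i dy_i - y_i dx_i. *)
Definition alpha (p v : V) : R :=
  zcoord v +
  2^-1 * \sum_(i < n) (xcoord p i * ycoord v i - ycoord p i * xcoord v i).

Definition ext_deriv (w : V -> V -> R) (p u v : V) : R :=
  'D_u (fun q => w q v) p - 'D_v (fun q => w q u) p.

Definition e_z : V := ((0, 0), 1).

Definition contact_field (H : V -> R) (X : V -> V) : Prop :=
  forall p, alpha p (X p) = H p /\
    forall v, ext_deriv alpha p (X p) v
              = 'D_e_z H p * alpha p v - 'd H p v.

(* Objects on [0, 1] x R^(2n+1) are represented by total functions of
   (t, p) in R x R^(2n+1), of which only the values for 0 <= t <= 1 matter.
   For smooth objects the total function is a smooth extension (one always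
   exists), so that two-sided time derivatives at t = 0 and t = 1 agree with
   the one-sided ones. *)

Definition contact_flow (H : R -> V -> R) (phi : R -> V -> V) : Prop :=
  [/\ smooth_on setT (fun q : (R * V)%type => phi q.1 q.2),
      forall p, phi 0 p = p &
      exists X : R -> V -> V,
        (forall t : R, 0 <= t <= 1 -> contact_field (H t) (X t)) /\
        (forall (t : R) (p : V), 0 <= t <= 1 ->
           is_derive t 1 (phi ^~ p) (X t (phi t p)))].

(* (phi^t)^* alpha = e^(h_t) alpha; this determines h, and makes it smooth on
   [0, 1] x R^(2n+1). *)
Definition conformal_factor (phi : R -> V -> V) (h : R -> V -> R) : Prop :=
  forall (t : R) (p v : V), 0 <= t <= 1 ->
    alpha (phi t p) ('d (phi t) p v) = expR (h t p) * alpha p v.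

Definition smooth_contact_ds
    (phi : R -> V -> V) (H h : R -> V -> R) : Prop :=
  [/\ smooth_on setT (fun q : (R * V)%type => H q.1 q.2),
      contact_flow H phi &
      conformal_factor phi h].

Definition isotopy_supported_in (K : set V) (phi : R -> V -> V) : Prop :=
  forall (t : R) (p : V), 0 <= t <= 1 -> ~ K p -> phi t p = p.

Definition supported_in (K : set V)
    (phi : R -> V -> V) (H h : R -> V -> R) : Prop :=
  isotopy_supported_in K phi /\
  (forall (t : R) (p : V), 0 <= t <= 1 -> ~ K p -> H t p = 0 /\ h t p = 0).

Definition homeomorphism (f : V -> V) : Prop :=
  exists g : V -> V,
    [/\ cancel f g, cancel g f, continuous f & continuous g].

Definition time_space : set (R * V)%type := `[0, 1] `*` setT.

Definition continuous_isotopy (phi : R -> V -> V) : Prop :=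
  [/\ {within time_space, continuous (fun q : (R * V)%type => phi q.1 q.2)},
      forall p, phi 0 p = p &
      forall t : R, 0 <= t <= 1 -> homeomorphism (phi t)].

Definition uniformly_cvg {W : normedModType R}
    (F : nat -> R -> V -> W) (G : R -> V -> W) : Prop :=
  {uniform time_space,
     (fun i => fun q : (R * V)%type => F i q.1 q.2) @ \oo -->
     (fun q : (R * V)%type => G q.1 q.2)}.

Definition sup_norm (f : V -> R) : \bar R :=
  ereal_sup [set (`|f p|)%:E | p in setT].

Definition sup_dist (H H' : R -> V -> R) (t : R) : \bar R :=
  sup_norm (fun p => H t p - H' t p).

(* int_0^1 sup |H_t - (H_i)_t| dt --> 0; the measurability clause guarantees
   that this integral is a genuine Lebesgue integral. *)
Definition L1_sup_cvg (Hs : nat -> R -> V -> R) (H : R -> V -> R) : Prop :=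
  (forall i, measurable_fun (`[0, 1] : set R) (sup_dist H (Hs i))) /\
  (\int[@lebesgue_measure R]_(t in `[0%R, 1%R]) sup_dist H (Hs i) t)%E
    @[i --> \oo] --> 0%E.

Definition continuous_contact_ds
    (phi : R -> V -> V) (H h : R -> V -> R) : Prop :=
  continuous_isotopy phi /\
  exists (K : set V) (phis : nat -> R -> V -> V) (Hs hs : nat -> R -> V -> R),
    [/\ compact K,
        supported_in K phi H h,
        forall i, smooth_contact_ds (phis i) (Hs i) (hs i) /\
                  supported_in K (phis i) (Hs i) (hs i) &
        [/\ uniformly_cvg phis phi,
            uniformly_cvg hs h &
            uniformly_cvg Hs H]].

Definition topological_contact_ds
    (phi : R -> V -> V) (H h : R -> V -> R) : Prop :=
  continuous_isotopy phi /\
  exists (K : set V) (phis : nat -> R -> V -> V) (Hs hs : nat -> R -> V -> R),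
    [/\ compact K,
        supported_in K phi H h,
        forall i, smooth_contact_ds (phis i) (Hs i) (hs i) /\
                  supported_in K (phis i) (Hs i) (hs i) &
        [/\ uniformly_cvg phis phi,
            uniformly_cvg hs h &
            L1_sup_cvg Hs H]].

Definition contact_homeomorphism (f : V -> V) : Prop :=
  exists (phi : R -> V -> V) (H h : R -> V -> R),
    topological_contact_ds phi H h /\ f = phi 1.

End ContactGeometry.

Section Construction.
Context {R : realType}.

(* int_r^1 s rho(s) ds, equal to 0 for r >= 1.  For r = 0 and nonnegative rho
   the Lebesgue integral over [0, 1] is the limit of the integrals over
   [r, 1] as r --> 0^+. *)
Definition tail_int (rho : R -> R) (r : R) : R :=
  (\int[@lebesgue_measure R]_(s in `[r, 1]) (s * rho s))%R.

Definition profile_ham {n : nat} (eta rho : R -> R) (p : contact_space R n) : R :=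
  eta (zcoord p) * tail_int rho (rad p).

Definition profile_conf {n : nat} (eta rho : R -> R)
    (phi : R -> contact_space R n -> contact_space R n) (t : R) (p : contact_space R n) : R :=
  (\int[@lebesgue_measure R]_(s in `[0, t])
     (derive1 eta (zcoord (phi s p)) * tail_int rho (rad (phi s p))))%R.

(* At r = 0 the term r^2 rho(r) is 0, which is its limit as r --> 0^+ when
   rho(r) = r^(-a) near 0 with a < 2. *)
Definition z_shift (rho : R -> R) (r : R) : R :=
  2^-1 * (r ^+ 2 * rho r) + tail_int rho r.

Definition singular_profile (a : R) (rho : R -> R) : Prop :=
  [/\ smooth_on [set r : R | 0 < r] rho,
      forall r : R, 0 < r -> 0 <= rho r,
      \forall r \near 0^'+, rho r = r `^ (- a),
      \forall r \near (1 : R), rho r = 0 &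
      forall r : R, 1 <= r -> rho r = 0].

Definition cutoff (eta : R -> R) : Prop :=
  [/\ smooth_on setT eta,
      forall z : R, 0 <= eta z <= 1,
      exists B : R, forall z : R, B < `|z| -> eta z = 0 &
      \forall z \near (0 : R), eta z = 1].

Definition compatible (eta rho : R -> R) : Prop :=
  exists2 u : R, 0 < u &
    forall z r : R, `|z| <= u -> 0 <= r ->
      eta (z + z_shift rho r) = 1 /\ eta (z - z_shift rho r) = 1.

Definition profile_approx (rho : R -> R) (eps : nat -> R)
    (rhos : nat -> R -> R) : Prop :=
  [/\ forall j, 0 < eps j,
      nonincreasing_seq eps,
      eps @ \oo --> (0 : R),
      forall j, smooth_on01 (rhos j) &
      [/\ forall j (r : R), eps j <= r <= 1 -> rhos j r = rho r,
          forall j (r : R), 0 <= r <= 1 -> 0 <= rhos j r,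
          forall j k (r : R), (j <= k)%N -> 0 <= r <= 1 -> rhos j r <= rhos k r &
          forall j (r : R), 0 < r <= 1 -> rhos j r <= rho r]].

End Construction.

(* Main.v *)
Require Import Defs.
From mathcomp Require Import all_boot all_order all_algebra.
From mathcomp Require Import all_classical all_reals all_analysis measurable_realfun.
From HB Require Import structures.
From mathcomp Require Import ring lra.
Import Order.TTheory GRing.Theory Num.Theory.
Import numFieldNormedType.Exports.
Local Open Scope classical_set_scope.
Local Open Scope ring_scope.

(* The approximating systems are the flows of H_j themselves, with conformal
   factor h_j = int_0^t (dH_j/dz) o phi_j^s ds.  For w(t) = alpha(D_v phi_j^t),
   the symmetry of the second derivatives D_t D_v and the two equations of the
   contact vector field give w' = (dH_j/dz) w, hence w = exp(h_j) w(0).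
   All supports lie in one compact box: a trajectory starting outside of it
   meets a vanishing field and never moves.  Since a < 2, s rho(s) is
   integrable at 0, so by dominated convergence the tails int_r^1 s rho_j(s) ds
   converge uniformly in r; this gives H_j -> H uniformly.  The integrand of h
   is continuous with compact support, hence uniformly continuous, so that
   phi_j -> phi yields h_j -> h.  As the Hamiltonians are autonomous, uniform
   and L^1-in-time convergence coincide. *)

Set Implicit Arguments.
Unset Strict Implicit.
Unset Printing Implicit Defensive.

(** * Symmetry of second derivatives *)

Lemma is_derive_along_line (R : realType) (V W : normedModType R) (f : V -> W)
    (u q : V) (s : R) :
  derivable f (s *: u + q) u ->
  is_derive s (1 : R) (fun r : R => f (r *: u + q)) ('D_u f (s *: u + q)).
Proof.
have E : (fun h : R => h^-1 *: (f ((h *: (1 : R) + s) *: u + q) - f (s *: u + q)))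
  = (fun h : R => h^-1 *: (f (h *: u + (s *: u + q)) - f (s *: u + q))).
  by apply/funext => h; rewrite scalerDl addrA [h *: 1]mulr1.
by move=> df; apply: DeriveDef; rewrite /derivable /derive/= E.
Qed.

(** The mean value theorem is applied twice: in direction [u] to the difference of [f] over the step
    [k *: v], then in direction [v] to ['D_u f]. *)
Lemma second_difference_mean_value (R : realType) (V : normedModType R) (f : V -> R)
    (u v p : V) (h k : R) :
  Ck_on setT 2 f -> 0 < h -> 0 < k ->
  exists c d : R, [/\ 0 < c < h, 0 < d < k &
    f (h *: u + (k *: v + p)) - f (h *: u + p) - (f (k *: v + p) - f p)
    = h * k * 'D_v (fun x => 'D_u f x) (d *: v + (c *: u + p))].
Proof.
move=> [df /(_ u)[ddf _]] h0 k0.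
pose F (s : R) := f (s *: u + (k *: v + p)) - f (s *: u + p).
pose F' (s : R) := 'D_u f (s *: u + (k *: v + p)) - 'D_u f (s *: u + p).
have dF s : is_derive s (1 : R) F (F' s).
  by apply: is_deriveB; apply: is_derive_along_line; exact/diff_derivable/df.
have cF : {within `[0, h], continuous F}.
  apply/continuous_subspaceT => s.
  exact/differentiable_continuous/derivable1_diffP.
have [c cI Ec] := MVT h0 (fun x _ => dF x) cF.
pose G (s : R) := 'D_u f (s *: v + (c *: u + p)).
have dG s : is_derive s (1 : R) G ('D_v (fun x => 'D_u f x) (s *: v + (c *: u + p))).
  by apply: is_derive_along_line; exact/diff_derivable/ddf.
have cG : {within `[0, k], continuous G}.
  apply/continuous_subspaceT => s.
  exact/differentiable_continuous/derivable1_diffP.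
have [d dI Ed] := MVT k0 (fun x _ => dG x) cG.
exists c, d; split; [by rewrite in_itv in cI|by rewrite in_itv in dI|].
move: Ec Ed; rewrite /F /F' /G !scale0r !add0r !subr0 => -> E.
by rewrite (addrCA (c *: u)) E; ring.
Qed.

(** Serves a limit argument in which the two sides are compared at different points, both
    arbitrarily near [p]. *)
Lemma eq_at_of_close_values (R : realType) (V : normedModType R) (f g : V -> R) (p : V) :
  {for p, continuous f} -> {for p, continuous g} ->
  (forall r : R, 0 < r -> exists x y, [/\ `|x| < r, `|y| < r & f (x + p) = g (y + p)]) ->
  f p = g p.
Proof.
move=> cf cg close.
apply/eqP; rewrite -subr_eq0 -normr_le0; apply/ler_addgt0Pl => e e0; rewrite addr0.
have e20 : 0 < e / 2 by rewrite divr_gt0.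
have /cvgrPdist_lt/(_ _ e20)/nbhs_ballP[a a0 Ha] := cf.
have /cvgrPdist_lt/(_ _ e20)/nbhs_ballP[b b0 Hb] := cg.
have [|x [y [+ + E]]] := close (Num.min a b); first by rewrite lt_min a0 b0.
rewrite !lt_min => /andP[xa _] /andP[_ yb].
have := Ha (x + p); rewrite -ball_normE/= opprD addrCA subrr addr0 normrN => /(_ xa) fx.
have := Hb (y + p); rewrite -ball_normE/= opprD addrCA subrr addr0 normrN => /(_ yb) gy.
rewrite E in fx.
have -> : f p - g p = (f p - g (y + p)) - (g p - g (y + p)) by ring.
by rewrite (splitr e) ltW//; apply: le_lt_trans (ler_normB _ _) (ltrD fx gy).
Qed.

(** The second difference over the parallelogram with sides [r *: u] and [r *: v] is symmetric in
    [u] and [v]. Dividing its two mean value expressions by [r * r] equates the mixed derivatives at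
    points near [p]; continuity does the rest. *)
Lemma derive_comm (R : realType) (V : normedModType R) (f : V -> R) (u v p : V) :
  Ck_on setT 2 f ->
  'D_v (fun x => 'D_u f x) p = 'D_u (fun x => 'D_v f x) p.
Proof.
move=> sf.
apply: (@eq_at_of_close_values _ _ (fun x => 'D_v (fun x => 'D_u f x) x)
  (fun x => 'D_u (fun x => 'D_v f x) x)).
- exact: ((sf.2 u).2 v p I).
- exact: ((sf.2 v).2 u p I).
move=> a a0.
have uv0 : 0 < `|u| + `|v| + 1 by rewrite ltr_wpDl// addr_ge0.
(* Combinations [x *: u + y *: v] with [0 < x, y < r] then have norm below [a]; the [+ 1] keeps the
   denominator positive when [u = v = 0]. *)
pose r := a / (`|u| + `|v| + 1).
have r0 : 0 < r by rewrite divr_gt0.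
have [c [d [/andP[c0 cr] /andP[d0 dr] E1]]] :=
  second_difference_mean_value u v p sf r0 r0.
have [c' [d' [/andP[c'0 c'r] /andP[d'0 d'r] E2]]] :=
  second_difference_mean_value v u p sf r0 r0.
have bnd (x y : R) : 0 < x -> x < r -> 0 < y -> y < r ->
    `|x *: u + y *: v| < a.
  move=> x0 xr y0 yr; apply: le_lt_trans (ler_normD _ _) _.
  rewrite !normrZ !gtr0_norm//.
  have -> : a = r * (`|u| + `|v| + 1) by rewrite divfK// gt_eqF.
  apply: (@le_lt_trans _ _ (r * (`|u| + `|v|))).
    by rewrite mulrDr lerD// ler_wpM2r// ltW.
  by rewrite ltr_pM2l// ltrDl.
exists (d *: v + c *: u), (d' *: u + c' *: v); split.
- by rewrite addrC; exact: bnd.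
- exact: bnd.
have r2 : r * r != 0 by rewrite mulf_neq0// gt_eqF.
apply: (mulfI r2); rewrite -!addrA -[LHS]E1 -[RHS]E2.
have swap (x y z w : R) : x - y - (z - w) = x - z - (y - w) by ring.
by rewrite (addrCA (r *: u)) swap.
Qed.

(** * Derivatives under continuous linear maps and along time and space slices *)

Section DerivativesOfCompositions.
Context {R : realType}.

Lemma is_derive_linear_comp (U W W' : normedModType R) (l : {linear W -> W'})
    (F : U -> W) (q u : U) (dF : W) :
  continuous l -> is_derive q u F dF -> is_derive q u (l \o F) (l dF).
Proof.
move=> cl [derF <-].
have E : (fun h : R => h^-1 *: ((l \o F) (h *: u + q) - (l \o F) q)) @ 0^'
    --> l ('D_u F q).
  rewrite (_ : (fun h : R => _) =
      l \o (fun h : R => h^-1 *: (F (h *: u + q) - F q))); last first.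
    by apply/funext => h /=; rewrite -linearB -linearZ.
  by have := @cvg_comp _ _ _ _ l _ _ _ derF; apply; exact: cl.
by apply: DeriveDef; [apply/cvg_ex; exists (l ('D_u F q))|exact: cvg_lim E].
Qed.

Lemma Ck_on_linear_comp (U W W' : normedModType R) (l : {linear W -> W'})
    (F : U -> W) (k : nat) :
  continuous l -> Ck_on setT k F -> Ck_on setT k (l \o F).
Proof.
move=> cl; elim: k F => [|k IH] F /=.
  by move=> cF x _; apply: continuous_comp; [exact: cF|exact: cl].
move=> [dF sF]; split=> [x _|v].
  by apply: differentiable_comp; [exact: dF|apply: linear_differentiable; exact: cl].
rewrite (_ : (fun x => _) = l \o (fun x => 'D_v F x)); first exact: IH.
apply/funext => x; apply: derive_val.
exact/is_derive_linear_comp/derivableP/diff_derivable/dF.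
Qed.

(** Time derivatives become directional derivatives on [R * V], where the symmetry of mixed
    derivatives applies. The product of two equalities is a rewriting rule for both derivability and
    value. *)
Lemma derivative_fst_slice (V W : normedModType R) (F : R * V -> W) (t : R) (p : V) :
  (derivable F (t, p) ((1, 0) : R * V) = derivable (fun s : R => F (s, p)) t 1) *
  ('D_((1, 0) : R * V) F (t, p) = 'D_(1 : R) (fun s => F (s, p)) t).
Proof.
have E : (fun h : R => h^-1 *: (F (h *: ((1, 0) : R * V) + (t, p)) - F (t, p)))
  = (fun h : R => h^-1 *: (F (h *: (1 : R) + t, p) - F (t, p))).
  apply/funext => h; congr (_ *: (F _ - _)).
  by rewrite [LHS]surjective_pairing /= scaler0 add0r.
by rewrite /derivable /derive /= E.
Qed.

Lemma derivative_snd_slice (V W : normedModType R) (F : R * V -> W) (t : R) (p v : V) :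
  'D_((0, v) : R * V) F (t, p) = 'D_v (fun q => F (t, q)) p.
Proof.
have E : (fun h : R => h^-1 *: (F (h *: ((0, v) : R * V) + (t, p)) - F (t, p)))
  = (fun h : R => h^-1 *: (F (t, h *: v + p) - F (t, p))).
  apply/funext => h; congr (_ *: (F _ - _)).
  by rewrite [LHS]surjective_pairing /= scaler0 add0r.
by rewrite /derive /= E.
Qed.

End DerivativesOfCompositions.

(** * The contact form along a contact flow *)

Section ContactForm.
Context {R : realType} {n : nat}.
Local Notation V := (contact_space R n).

(** The constant two-form [d alpha], the sum of the [dx_i /\ dy_i]. *)
Definition symp (u v : V) : R :=
  \sum_(i < n) (xcoord u i * ycoord v i - ycoord u i * xcoord v i).

Lemma alphaE (p v : V) : alpha p v = zcoord v + 2^-1 * symp p v.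
Proof. by []. Qed.

Lemma sympC (u v : V) : symp v u = - symp u v.
Proof. by rewrite /symp -sumrN; apply: eq_bigr => i _; ring. Qed.

(** The index comes first, so that for fixed [i] the coordinate is a function on [V] that can carry
    a linear structure. *)
Definition xcoord_at (i : 'I_n) (p : V) : R := xcoord p i.
Definition ycoord_at (i : 'I_n) (p : V) : R := ycoord p i.

Lemma xcoord_linear (i : 'I_n) : linear (xcoord_at i).
Proof. by move=> a u v; rewrite /xcoord_at /xcoord/= !mxE. Qed.

Lemma ycoord_linear (i : 'I_n) : linear (ycoord_at i).
Proof. by move=> a u v; rewrite /ycoord_at /ycoord/= !mxE. Qed.

Lemma zcoord_linear : linear (@zcoord R n).
Proof. by []. Qed.

HB.instance Definition _ (i : 'I_n) :=
  GRing.isLinear.Build R V R _ _ (xcoord_linear i).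
HB.instance Definition _ (i : 'I_n) :=
  GRing.isLinear.Build R V R _ _ (ycoord_linear i).
HB.instance Definition _ := GRing.isLinear.Build R V R _ _ zcoord_linear.

Lemma xcoord_continuous (i : 'I_n) : continuous (xcoord_at i).
Proof.
move=> p; apply: (@continuous_comp _ _ _ (fun p : V => p.1.1) (fun m => m 0 i)).
  by apply: continuous_comp; exact: cvg_fst.
exact: coord_continuous.
Qed.

Lemma ycoord_continuous (i : 'I_n) : continuous (ycoord_at i).
Proof.
move=> p; apply: (@continuous_comp _ _ _ (fun p : V => p.1.2) (fun m => m 0 i)).
  by apply: continuous_comp; [exact: cvg_fst|exact: cvg_snd].
exact: coord_continuous.
Qed.

Lemma zcoord_continuous : continuous (@zcoord R n).
Proof. by move=> p; exact: cvg_snd. Qed.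

Lemma coord_inj (u v : V) :
  (forall i, xcoord u i = xcoord v i) -> (forall i, ycoord u i = ycoord v i) ->
  zcoord u = zcoord v -> u = v.
Proof.
case: u v => -[ux uy] uz [[vx vy] vz]; rewrite /xcoord /ycoord /zcoord /=.
move=> ex ey ->; congr ((_, _), _).
  by apply/rowP => i; rewrite ex.
by apply/rowP => i; rewrite ey.
Qed.

Lemma is_derive_symp (U : normedModType R) (F G : U -> V) (q u : U) (dF dG : V) :
  is_derive q u F dF -> is_derive q u G dG ->
  is_derive q u (fun x => symp (F x) (G x)) (symp dF (G q) + symp (F q) dG).
Proof.
move=> FdF GdG; rewrite /symp.
rewrite (_ : (fun x => _) = \sum_(i < n)
    ((xcoord_at i \o F) * (ycoord_at i \o G)
   - (ycoord_at i \o F) * (xcoord_at i \o G))); last first.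
  by apply/funext => x; rewrite fct_sumE.
have dx i F' dF' : is_derive q u F' dF' ->
    is_derive q u (xcoord_at i \o F') (xcoord dF' i).
  by move=> ?; apply: is_derive_linear_comp => //; exact: xcoord_continuous.
have dy i F' dF' : is_derive q u F' dF' ->
    is_derive q u (ycoord_at i \o F') (ycoord dF' i).
  by move=> ?; apply: is_derive_linear_comp => //; exact: ycoord_continuous.
have dxF i := dx i _ _ FdF; have dxG i := dx i _ _ GdG.
have dyF i := dy i _ _ FdF; have dyG i := dy i _ _ GdG.
apply: is_derive_eq; rewrite -big_split/=; apply: eq_bigr => i _.
by rewrite /GRing.scale/= /xcoord_at /ycoord_at; ring.
Qed.

(** [alpha] is linear in the vector and affine in the base point; moving the base point by [dF]
    contributes [2^-1 * symp dF (G q)]. *)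
Lemma is_derive_alpha (U : normedModType R) (F G : U -> V) (q u : U) (dF dG : V) :
  is_derive q u F dF -> is_derive q u G dG ->
  is_derive q u (fun x => alpha (F x) (G x))
    (alpha (F q) dG + 2^-1 * symp dF (G q)).
Proof.
move=> FdF GdG.
have dz : is_derive q u (@zcoord R n \o G) (zcoord dG).
  by apply: is_derive_linear_comp => //; exact: zcoord_continuous.
have ds := is_derive_symp FdF GdG.
rewrite (_ : (fun x => _) = (@zcoord R n \o G)
   + (2^-1 : R) \*: (fun x => symp (F x) (G x))); last by [].
apply: is_derive_eq; rewrite !alphaE /GRing.scale/=; ring.
Qed.

Lemma ext_deriv_alpha (p u v : V) : ext_deriv alpha p u v = symp u v.
Proof.
have H w w' : 'D_w (fun q => alpha q w') p = 2^-1 * symp w w'.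
  have := is_derive_alpha (is_derive_id p w) (is_derive_cst w' p w).
  move=> /@derive_val ->; rewrite alphaE /zcoord /symp /=.
  rewrite big1 ?mulr0 ?add0r//= => i _.
  by rewrite /xcoord /ycoord/= !mxE; ring.
by rewrite /ext_deriv !H (sympC u v); move: (symp u v) => s; field.
Qed.

(** Continuous linear coordinates commute with derivatives, so the scalar case applies to each of
    them, and together they determine the vector. *)
Lemma derive_comm_contact (U : normedModType R) (F : U -> V) (u v p : U) :
  Ck_on setT 2 F ->
  'D_v (fun x => 'D_u F x) p = 'D_u (fun x => 'D_v F x) p.
Proof.
move=> sF.
have coordC (l : {linear V -> R}) : continuous l ->
    l ('D_v (fun x => 'D_u F x) p) = l ('D_u (fun x => 'D_v F x) p).
  move=> cl.
  have D w x : 'D_w (l \o F) x = l ('D_w F x).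
    apply: derive_val; apply: is_derive_linear_comp => //.
    exact/derivableP/diff_derivable/(sF.1 x).
  have DD w w' : 'D_w' (fun x => 'D_w (l \o F) x) p
      = l ('D_w' (fun x => 'D_w F x) p).
    rewrite (_ : (fun x => _) = l \o (fun x => 'D_w F x)); last exact/funext/D.
    apply: derive_val; apply: is_derive_linear_comp => //.
    exact/derivableP/diff_derivable/((sF.2 w).1 p).
  have sl : Ck_on setT 2 (l \o F) by exact: Ck_on_linear_comp.
  have E := derive_comm u v p sl.
  exact: etrans (esym (DD u v)) (etrans E (DD v u)).
have X i := coordC (xcoord_at i) (@xcoord_continuous i).
have Y i := coordC (ycoord_at i) (@ycoord_continuous i).
exact: (coord_inj X Y (coordC (@zcoord R n) zcoord_continuous)).
Qed.

End ContactForm.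

(** * Evolution of the contact form under a contact flow *)

Section Pullback.
Context {R : realType} {n : nat}.
Local Notation V := (contact_space R n).

(** With [A] and [W] the values of [alpha] on the time and space derivatives of the flow, the mixed
    second derivatives cancel in [D_t W - D_v A], leaving [d alpha (X, dphi v)]. The contact
    equation evaluates this as [D_z H * W - dH (dphi v)], and [D_v A = dH (dphi v)] because [A] is
    [H] along the flow. *)
Lemma is_derive_pullback_alpha (H : R -> V -> R) (phi : R -> V -> V) (t : R) (p v : V) :
  contact_flow H phi -> 0 <= t <= 1 -> (forall q, differentiable (H t) q) ->
  is_derive t (1 : R) (fun s => alpha (phi s p) ('d (phi s) p v))
    ('D_e_z (H t) (phi t p) * alpha (phi t p) ('d (phi t) p v)).
Proof.
move=> [sphi _ [X [XH phiX]]] t01 dH.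
pose F (q : R * V) := phi q.1 q.2; have {}sphi : smooth_on setT F by [].
have dF q : differentiable F q by exact: (sphi 1).1.
have dslice s q : differentiable (phi s) q.
  exact: (@differentiable_comp _ _ _ _ (fun x => (s, x)) F).
pose e1 : R * V := (1, 0); pose ev : R * V := (0, v).
have dDF w q : differentiable (fun x => 'D_w F x) q by exact: ((sphi 2).2 w).1.
have Dev s q : 'D_ev F (s, q) = 'd (phi s) q v.
  exact: etrans (derivative_snd_slice F s q v) (deriveE v (dslice s q)).
have De1 q : 'D_e1 F (t, q) = X t (phi t q).
  exact: etrans (derivative_fst_slice F t q).2 (@derive_val _ _ _ _ _ _ _ (phiX t q t01)).
pose A q := alpha (F q) ('D_e1 F q); pose W q := alpha (F q) ('D_ev F q).
have derF w q : is_derive q w F ('D_w F q) by exact/derivableP/diff_derivable.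
have derDF w w' q : is_derive q w (fun x => 'D_w' F x) ('D_w (fun x => 'D_w' F x) q).
  exact/derivableP/diff_derivable.
have dA := is_derive_alpha (derF ev (t, p)) (derDF ev e1 (t, p)).
have dW := is_derive_alpha (derF e1 (t, p)) (derDF e1 ev (t, p)).
have dHphi : 'D_v (H t \o phi t) p = 'd (H t) (phi t p) ('d (phi t) p v).
  have dc : differentiable (H t \o phi t) p by exact: differentiable_comp.
  have dE := diff_comp (dslice t p) (dH (phi t p)).
  have E := deriveE v dc.
  exact: etrans E (congr1 (fun g => g v) dE).
(* [A] is identified on the slice at time [t] only, which suffices because [ev] is tangent to that
   slice. *)
have EAf : (fun q => A (t, q)) = H t \o phi t.
  by apply/funext => q; rewrite /A De1 /= (XH t t01 (phi t q)).1.
have EA : 'D_ev A (t, p) = 'd (H t) (phi t p) ('d (phi t) p v).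
  by rewrite (derivative_snd_slice A t p v) EAf.
have derW : derivable (fun s => W (s, p)) t 1.
  by have [+ _] := dW; rewrite (derivative_fst_slice W).
rewrite (_ : (fun s => _) = fun s => W (s, p)); last first.
  by apply/funext => s; rewrite /W Dev.
apply: (DeriveDef derW); rewrite -(derivative_fst_slice W t p).
have C := derive_comm_contact e1 ev (t, p) (sphi 2).
have vA := etrans (@derive_val _ _ _ _ _ _ _ dA)
  (congr2 (fun a b => alpha (phi t p) _ + 2^-1 * symp a b) (Dev t p) (De1 p)).
have vW := etrans (@derive_val _ _ _ _ _ _ _ dW)
  (congr2 (fun a b => alpha (phi t p) _ + 2^-1 * symp a b) (De1 p) (Dev t p)).
rewrite -C in vW.
apply: etrans vW _.
have {}vA := etrans (esym EA) vA.
have cX := (XH t t01 (phi t p)).2 ('d (phi t) p v).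
rewrite ext_deriv_alpha in cX.
move: vA cX; rewrite (sympC _ ('d (phi t) p v)).
move: (symp _ _) (alpha (phi t p) _) (alpha (phi t p) _) ('d (H t) _ _) => a b c d.
lra.
Qed.

End Pullback.

(** * Integrals of the radial profile *)

Section TailIntegral.
Context {R : realType}.
Local Notation mu := (@lebesgue_measure R).
Implicit Types (rho : R -> R).

(** The intervals [[c / (k + 2), c]] exhaust []0, c]]. On each, the fundamental theorem of calculus
    bounds the integral by [c^(b+1) / (b+1)], using [b + 1 > 0], and monotone convergence keeps the
    bound. *)
Lemma integrable_powR (b c : R) : -1 < b -> 0 < c ->
  mu.-integrable `]0, c] (EFin \o (fun s : R => s `^ b)).
Proof.
move=> b1 c0; have b0 : 0 < b + 1 by rewrite -ltrBlDr sub0r.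
have mpow (D : set R) : measurable_fun D (EFin \o (fun s : R => s `^ b)).
  by apply/measurable_EFinP; apply: measurable_funTS; exact: measurable_powR.
apply/integrableP; split; first exact: mpow.
under eq_integral => x _ do rewrite /= ger0_norm ?powR_ge0//.
(* The shift to [k.+2] makes every interval nondegenerate, already for [k = 0]. *)
pose F (k : nat) := `[c / k.+2%:R, c]%classic : set R.
have ck0 k : 0 < c / k.+2%:R :> R by rewrite divr_gt0.
have ckc k : c / k.+2%:R < c by rewrite ltr_pdivrMr// ltr_pMr// ltr1n.
have FE : `]0, c]%classic = \bigcup_k F k.
  apply/seteqP; split => [x|x [k _]]; rewrite /F/= !in_itv/=.
    move=> /andP[x0 xc]; have cx0 : 0 <= c / x by rewrite divr_ge0// ltW.
    exists (Num.truncn (c / x)) => //; rewrite /F/= in_itv/= xc andbT.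
    rewrite ler_pdivrMr// mulrC -ler_pdivrMr// ltW//.
    apply: (lt_le_trans (truncnS_gt _)); first by rewrite ler_nat.
  by move=> /andP[ckx ->]; rewrite (lt_le_trans (ck0 k)).
rewrite FE.
have Fk k : (\int[mu]_(x in F k) (x `^ b)%:E <= (c `^ (b + 1) / (b + 1))%:E)%E.
  have dP (x : R) : 0 < x -> is_derive x (1 : R) (fun s : R => s `^ (b + 1) / (b + 1)) (x `^ b).
    move=> x0; have := is_derive1_powR (b + 1) x0; rewrite addrK => d.
    rewrite (_ : (fun s => _) = (b + 1)^-1 \*: (fun s : R => s `^ (b + 1))); last first.
      by apply/funext => s; rewrite /GRing.scale/= mulrC.
    apply: is_derive_eq; rewrite /GRing.scale/= mulKf//; exact: lt0r_neq0.
  have cP (x : R) : 0 < x -> {for x, continuous (fun s : R => s `^ (b + 1) / (b + 1))}.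
    by move=> x0; apply/differentiable_continuous/derivable1_diffP; case: (dP x x0).
  rewrite /F (@continuous_FTC2 _ _ (fun s => s `^ (b + 1) / (b + 1))) //.
  - rewrite -EFinB lee_fin gerBl divr_ge0 ?powR_ge0// ltW//.
  - apply: derivable_within_continuous => x; rewrite in_itv/= => /andP[cx _].
    have x0 := lt_le_trans (ck0 k) cx.
    by case: (is_derive1_powR b x0).
  - split.
    + move=> x; rewrite in_itv/= => /andP[cx _].
      by case: (dP x (lt_trans (ck0 k) cx)).
    + by apply: cvg_at_right_filter; exact: cP.
    + by apply: cvg_at_left_filter; exact: cP.
  - move=> x; rewrite in_itv/= => /andP[cx _].
    by rewrite derive1E; case: (dP x (lt_trans (ck0 k) cx)).
have ndF : nondecreasing_seq F.
  move=> m k mk; apply/subsetPset => x; rewrite /F/= !in_itv/= => /andP[cx ->].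
  rewrite andbT (le_trans _ cx)// ler_pM2l// lef_pV2 ?posrE// ler_nat.
  by rewrite !ltnS.
have cvgF : (\int[mu]_(x in F k) (x `^ b)%:E)%E @[k --> \oo]
    --> (\int[mu]_(x in \bigcup_k F k) (x `^ b)%:E)%E.
  apply: ge0_nondecreasing_set_cvg_integral => // [k|k|k x _].
  - exact: measurable_itv.
  - exact: mpow.
  - by rewrite lee_fin powR_ge0.
apply: le_lt_trans (ltry (c `^ (b + 1) / (b + 1))).
apply: (cvge_to_le cvgF); exact: nearW.
Qed.

Lemma continuous_comp_within (T : topologicalType) (A : set R) (f : R -> R) (g : T -> R) :
  {within A, continuous f} -> continuous g -> (forall x, A (g x)) ->
  continuous (f \o g).
Proof.
move=> /subspace_continuousP cf cg gA x U fU.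
have := cf (g x) (gA x) U fU; rewrite /= /within/= => /cg gU.
have {}gU : nbhs x (fun y => A (g y) -> U (f (g y))) := gU.
suff : nbhs x (fun y => U (f (g y))) by [].
by apply: filterS gU => y; apply.
Qed.

(** The factor [s] softens the singularity [s^(-a)] to [s^(1-a)], which is integrable at 0 for all
    [a < 2]. *)
Definition integrable_profile rho : Prop :=
  mu.-integrable `[0, 1] (EFin \o (fun s : R => s * rho s)).

(** Moves the dependence on [r] to the upper end of an integral, in which continuity is available;
    [Num.min r 1] yields the value 0 for every [r >= 1]. *)
Lemma tail_intE rho (r : R) : integrable_profile rho -> 0 <= r ->
  tail_int rho r = \int[mu]_(s in `[0, 1]) (s * rho s)
    - \int[mu]_(s in `[0, Num.min r 1]) (s * rho s).
Proof.
move=> irho r0; rewrite /tail_int; have [r1|r1] := leP r 1; last first.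
  by rewrite set_itv_ge ?bnd_simp -?ltNge// Rintegral_set0 subrr.
have rint : mu.-integrable `]r, 1] (EFin \o (fun s : R => s * rho s)).
  apply: integrableS irho => //; apply: subset_itvScc => //; rewrite bnd_simp//.
by rewrite Rintegral_itvB ?bnd_simp// Rintegral_itv_obnd_cbnd.
Qed.

Lemma tail_int_comp_continuous rho (T : topologicalType) (g : T -> R) :
  integrable_profile rho -> continuous g -> (forall x, 0 <= g x) ->
  continuous (tail_int rho \o g).
Proof.
move=> irho cg g0.
rewrite (_ : _ \o _ = (fun x => \int[mu]_(s in `[0, 1]) (s * rho s)
    - ((fun x => \int[mu]_(s in `[0, x]) (s * rho s)) \o (fun x => Num.min (g x) 1)) x));
  last by apply/funext => x /=; rewrite tail_intE.
move=> x; apply: cvgB; first exact: cvg_cst.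
apply: (@continuous_comp_within _ `[0, 1]).
- exact: parameterized_integral_continuous.
- by move=> y; apply: (@continuous_min _ _ g (cst 1)); [exact: cg|exact: cvg_cst].
- by move=> y; rewrite /= in_itv/= le_min g0 ler01 ge_min lexx orbT.
Qed.

Lemma tail_int_ge1 rho (r : R) : 1 <= r -> tail_int rho r = 0.
Proof.
rewrite le_eqVlt /tail_int => /predU1P[<-|r1]; first by rewrite set_itv1 Rintegral_set1.
by rewrite set_itv_ge ?bnd_simp -?ltNge// Rintegral_set0.
Qed.

Lemma tail_intB rho rho' (r : R) : integrable_profile rho ->
  integrable_profile rho' -> 0 <= r ->
  tail_int rho r - tail_int rho' r = tail_int (fun s => rho s - rho' s) r.
Proof.
move=> irho irho' r0.
have sub : (`[r, 1]%classic : set R) `<=` `[0, 1]%classic by apply: subset_itvr; rewrite bnd_simp.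
rewrite /tail_int -RintegralB//; [|exact: integrableS irho|exact: integrableS irho'].
by apply: eq_Rintegral => s _; rewrite mulrBr.
Qed.

Lemma integrable_profileB rho rho' : integrable_profile rho ->
  integrable_profile rho' -> integrable_profile (fun s => rho s - rho' s).
Proof.
move=> irho irho'; have m01 : measurable (`[0, 1]%classic : set (measurableTypeR R)) by [].
have := integrableB m01 irho irho'.
by apply: eq_integrable => // s _ /=; rewrite mulrBr EFinB.
Qed.

(** For a nonnegative profile the tail is largest at [r = 0], so that one number controls all
    radii. *)
Lemma tail_int_bound rho (r : R) : integrable_profile rho ->
  (forall s, 0 < s <= 1 -> 0 <= rho s) -> 0 <= r ->
  0 <= tail_int rho r <= tail_int rho 0.
Proof.
move=> irho rho0 r0.
have srho0 s : 0 <= s <= 1 -> 0 <= s * rho s.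
  move=> /andP[]; rewrite le_eqVlt => /predU1P[<-|s0 s1]; first by rewrite mul0r.
  by rewrite mulr_ge0// ?rho0 ?s0// ltW.
rewrite Rintegral_ge0/=; last first.
  by move=> s; rewrite /= in_itv/= => /andP[rs s1]; rewrite srho0// s1 (le_trans r0).
rewrite !tail_intE// lerB//.
rewrite (_ : Num.min 0 1 = 0); last by apply/min_idPl.
rewrite set_itv1 Rintegral_set1 Rintegral_ge0//= => s.
by rewrite /= in_itv/= le_min => /and3P[s0 _ s1]; rewrite srho0// s0.
Qed.

Lemma smooth_integrable_profile rho : smooth_on01 rho -> integrable_profile rho.
Proof.
move=> [g [sg grho]].
have cg : continuous g by move=> x; exact: (sg 0).
have : mu.-integrable `[0, 1] (EFin \o (fun s : R => s * g s)).
  apply: continuous_compact_integrable; first exact: segment_compact.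
  by apply: continuous_subspaceT => s; apply: cvgM => //; exact: cg.
apply: eq_integrable => //.
by move=> s; rewrite inE/= in_itv/= => s01; rewrite grho.
Qed.

Lemma integrable_setU (A B : set R) (f : R -> \bar R) :
  measurable A -> measurable B -> [disjoint A & B] ->
  mu.-integrable A f -> mu.-integrable B f -> mu.-integrable (A `|` B) f.
Proof.
move=> mA mB AB /integrableP[mAf iA] /integrableP[mBf iB].
have mf : measurable_fun (A `|` B) f by apply/measurable_funU.
apply/integrableP; split => //; rewrite ge0_integral_setU//.
  exact: lte_add_pinfty.
exact: measurableT_comp.
Qed.

Lemma integrable_set1 (x : R) (f : R -> \bar R) : mu.-integrable [set x] f.
Proof.
by apply/integrableP; split; [exact: measurable_fun_set1|rewrite integral_set1].
Qed.

(** On []0, c]] the integrand is [s^(1-a)] with [1 - a > -1]; on [[c, 1]] it is continuous. *)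
Lemma singular_integrable_profile (a : R) rho : a < 2 -> singular_profile a rho ->
  integrable_profile rho.
Proof.
move=> a2 [srho _ + _ _] => -[d /= d0 rhod].
(* [c] lies strictly inside the range [d] on which [rho] is the power, and does not exceed 1. *)
pose c := Num.min (d / 2) 1.
have c0 : 0 < c by rewrite lt_min ltr01 divr_gt0.
have c1 : c <= 1 by rewrite ge_min lexx orbT.
have cd : c < d by rewrite gt_min ltr_pdivrMr// ltr_pMr// ltr1n.
rewrite /integrable_profile.
have -> : `[0, 1]%classic = [set 0] `|` (`]0, c] `|` `]c, 1]) :> set R.
  apply/seteqP; split => x; rewrite /= !in_itv/=.
    move=> /andP[]; rewrite le_eqVlt => /predU1P[<-|-> ->]; first by left.
    by right; case: (leP x c); [left|right].
  move=> [->|]; first by rewrite lexx ler01.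
  move=> [/andP[x0 xc]|/andP[cx ->]]; first by rewrite ltW// (le_trans xc).
  by rewrite (ltW (lt_trans c0 cx)).
apply: integrable_setU => //.
- exact: measurableU.
- apply/disj_setPRL => x; rewrite /= !in_itv/=.
  move=> [/andP[x0 _]|/andP[/(lt_trans c0) x0 _]] xE; by rewrite xE ltxx in x0.
- exact: integrable_set1.
apply: integrable_setU => //.
- apply/disj_setPRL => x; rewrite /= !in_itv/= => /andP[cx _].
  by rewrite leNgt cx andbF.
- have : mu.-integrable `]0, c] (EFin \o (fun s : R => s `^ (1 - a))).
    by apply: integrable_powR => //; lra.
  apply: eq_integrable => // x; rewrite inE/= in_itv/= => /andP[x0 xc].
  rewrite rhod//=; last by rewrite sub0r normrN gtr0_norm// (le_lt_trans xc).
  by rewrite powRD ?powRr1 ?ltW// (gt_eqF x0) implybT.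
have : mu.-integrable `[c, 1] (EFin \o (fun s : R => s * rho s)).
  apply: continuous_compact_integrable; first exact: segment_compact.
  apply/continuous_in_subspaceT => x; rewrite inE/= in_itv/= => /andP[cx _].
  apply: cvgM; first exact: cvg_id.
  exact: (srho 0 x (lt_le_trans c0 cx)).
by apply: integrableS => //; exact: subset_itv_oc_cc.
Qed.

End TailIntegral.

(** * Uniform convergence of the tail integrals *)

Section ProfileApproximation.
Context {R : realType}.
Local Notation mu := (@lebesgue_measure R).

(** For fixed [s > 0] the gap [rho s - rhos j s] vanishes once [eps j < s], and [s * rho s]
    dominates. As the gap is nonnegative, its tail at 0 bounds its tail at every [r], which gives
    uniformity. *)
Lemma approx_tail_int_cvg (a : R) (rho : R -> R) (eps : nat -> R)
    (rhos : nat -> R -> R) :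
  a < 2 -> singular_profile a rho -> profile_approx rho eps rhos ->
  forall e : R, 0 < e -> \forall j \near \oo, forall r : R, 0 <= r ->
    `|tail_int rho r - tail_int (rhos j) r| < e.
Proof.
move=> a2 rhoP [eps0 _ epscvg srhos [rhosE rhos0 _ rhosle]].
have irho := singular_integrable_profile a2 rhoP.
have irhos j : integrable_profile (rhos j) by exact: smooth_integrable_profile.
have idiff j := integrable_profileB irho (irhos j).
have m01 : measurable (`[0, 1]%classic : set (measurableTypeR R)) by [].
have diff0 j (s : R) : 0 < s <= 1 -> 0 <= rho s - rhos j s.
  by move=> s01; rewrite subr_ge0 rhosle.
pose f j (s : R) := (s * (rho s - rhos j s))%:E.
have [_ _ cvgf] : [/\ mu.-integrable `[0, 1] (cst 0%E : R -> \bar R),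
  [sequence (\int[mu]_(s in `[0%R, 1%R]) `|f j s - 0|)%E]_j @ \oo --> 0%E &
  [sequence (\int[mu]_(s in `[0%R, 1%R]) f j s)%E]_j @ \oo -->
    (\int[mu]_(s in `[0%R, 1%R]) cst 0%E s)%E].
  apply: (@dominated_convergence _ _ _ mu _ m01 f (cst 0%E)
      (EFin \o (fun s : R => s * rho s))) => //.
  - by move=> j; have /integrableP[] := idiff j.
  - apply: aeW => s /=; rewrite in_itv/= => /andP[].
    rewrite le_eqVlt => /predU1P[<- _|s0 s1].
      by rewrite /f; under eq_fun do rewrite mul0r; exact: cvg_cst.
    have : \forall j \near \oo, f j s = 0%E.
      have /cvgrPdist_lt/(_ _ s0) := epscvg.
      apply: filterS => j; rewrite sub0r normrN gtr0_norm// => epsj.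
      by rewrite /f rhosE ?subrr ?mulr0// s1 ltW.
    by move=> fj0; apply: cvg_near_cst; exact: fj0.
  - apply: aeW => s j /=; rewrite in_itv/= => /andP[].
    rewrite le_eqVlt => /predU1P[<- _|s0 s1]; first by rewrite /f !mul0r normr0.
    have s01 : 0 < s <= 1 by rewrite s0.
    rewrite /f lee_fin normrM (gtr0_norm s0) ger0_norm ?diff0// ler_pM2l// gerBl.
    by rewrite rhos0// s1 ltW.
rewrite integral0 in cvgf.
have cvg0 : (fun j => tail_int (fun s => rho s - rhos j s) 0) @ \oo --> 0.
  exact: (fine_cvg cvgf).
move=> e e0; have /cvgrPdist_lt/(_ _ e0) := cvg0.
apply: filterS => j; rewrite sub0r normrN => small r r0.
rewrite tail_intB//; apply: le_lt_trans small.
have /andP[tr0 tr] := tail_int_bound (idiff j) (diff0 j) r0.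
by rewrite !ger0_norm// (le_trans tr0).
Qed.

End ProfileApproximation.

(** * Conformal factor and support of a contact flow *)

Section RealODE.
Context {R : realType}.
Local Notation mu := (@lebesgue_measure R).

Lemma eq_of_is_derive0 (f : R -> R) (a b : R) : a <= b ->
  (forall x : R, a < x < b -> is_derive x (1 : R) f 0) ->
  {within `[a, b], continuous f} -> f b = f a.
Proof.
move=> ab df cf; apply/eqP; rewrite -subr_eq0.
have df0 (x : R) : x \in `]a, b[ -> is_derive x (1 : R) f ((fun=> 0) x).
  by rewrite in_itv/=; exact: df.
by have [c _ ->] := MVT_segment ab df0 cf; rewrite mul0r.
Qed.

(** [expR (- I)] is an integrating factor: [w * expR (- I)] has zero derivative. *)
Lemma linear_ode_solution (g w : R -> R) : continuous g ->
  (forall t : R, 0 <= t <= 1 -> is_derive t (1 : R) w (g t * w t)) ->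
  forall t : R, 0 <= t <= 1 ->
    w t = expR (\int[mu]_(s in `[0, t]) g s) * w 0.
Proof.
move=> cg dw t /andP[t0 t1].
pose I (x : R) := \int[mu]_(s in `[0, x]) g s.
have ig : mu.-integrable `[0, 1] (EFin \o g).
  apply: continuous_compact_integrable; first exact: segment_compact.
  by apply: continuous_subspaceT.
(* [I] is differentiated in the open interval only; the end points are reached by continuity. *)
have dI (x : R) : 0 < x < 1 -> is_derive x (1 : R) I (g x).
  move=> /andP[x0 x1].
  have [dIx <-] := continuous_FTC1_closed x1 ig x0 (cg x).
  by rewrite derive1E; exact: derivableP.
have sub0t : (`[0, t]%classic : set R) `<=` `[0, 1]%classic.
  by apply: subset_itvl; rewrite bnd_simp.
have cI : {within `[0, t], continuous I}.
  apply: continuous_subspaceW (parameterized_integral_continuous ler01 ig).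
  exact: sub0t.
have : w t * expR (- I t) = w 0 * expR (- I 0).
  apply: (@eq_of_is_derive0 (fun x => w x * expR (- I x))) => // [x /andP[x0 xt]|].
    have x1 := lt_le_trans xt t1.
    have dwx : is_derive x (1 : R) w (g x * w x) by apply: dw; rewrite !ltW.
    have dIx : is_derive x (1 : R) I (g x) by apply: dI; rewrite x0.
    rewrite (_ : (fun x => _) = w * (expR \o (- I))) //.
    apply: is_derive_eq.
    by rewrite /GRing.scale/=; ring.
  move=> x; apply: cvgM.
    apply: (continuous_subspaceW sub0t); apply: derivable_within_continuous.
    by move=> y; rewrite in_itv/= => y01; case: (dw y y01).
  have cNI : {for x, continuous (- I : subspace `[0, t] -> R)}.
    by apply: cvgN; exact: (cI x).
  exact: (continuous_comp cNI (@continuous_expR _ _)).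
rewrite {2}/I set_itv1 Rintegral_set1 oppr0 expR0 mulr1 => <-.
by rewrite mulrC -mulrA -expRD addNr expR0 mulr1.
Qed.

End RealODE.

(** * Conformal factor and support of contact flows, and tools for uniform convergence *)

Section ContactFlows.
Context {R : realType} {n : nat}.
Local Notation V := (contact_space R n).
Local Notation mu := (@lebesgue_measure R).
Implicit Types (H : V -> R) (phi : R -> V -> V).

Lemma flow_conformal_factor H phi :
  contact_flow (fun _ => H) phi -> (forall q, differentiable H q) ->
  continuous (fun q : V => 'D_e_z H q) ->
  conformal_factor phi
    (fun t p => \int[mu]_(s in `[0, t]) 'D_e_z H (phi s p)).
Proof.
move=> flow dH cH t p v t01.
have [sphi phi0 _] := flow.
have cphi : continuous (fun s => phi s p).
  move=> s; have cF := sphi 0 (s, p) I.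
  have cs : {for s, continuous (fun s : R => (s, p))}.
    exact: differentiable_continuous.
  exact: (continuous_comp cs cF).
pose g s := 'D_e_z H (phi s p).
have cg : continuous g.
  by move=> s; apply: (@continuous_comp _ _ _ (fun s => phi s p) (fun q => 'D_e_z H q)); [exact: cphi|exact: cH].
pose w s := alpha (phi s p) ('d (phi s) p v).
have dw (s : R) : 0 <= s <= 1 -> is_derive s (1 : R) w (g s * w s).
  by move=> s01; exact: (@is_derive_pullback_alpha _ _ (fun _ => H)).
rewrite -[LHS]/(w t) (linear_ode_solution cg dw t01); congr (_ * _).
have phi0E : phi 0 = id by apply/funext => q; rewrite phi0.
by rewrite /w phi0E diff_val.
Qed.

(** Since [H] vanishes near [p], so does its derivative at [p], hence [symp (X p)] is zero and
    nondegeneracy kills the [x] and [y] components; [alpha p (X p) = H p = 0] then kills the [z]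
    component. *)
Lemma contact_field_eq0 H X (p : V) : contact_field H X ->
  differentiable H p -> (\forall q \near p, H q = 0) -> X p = 0.
Proof.
move=> /(_ p)[alphaX dalphaX] dH H0.
have D0 v : 'D_v H p = 0.
  rewrite (@near_eq_derive _ _ _ H (cst 0)); first exact: derive_cst.
  exact: H0.
have symp0 v : symp (X p) v = 0.
  by have := dalphaX v; rewrite ext_deriv_alpha D0 mul0r sub0r -deriveE// D0 oppr0.
(* Pairing [X p] with its rotation by a right angle gives the sum of the squares of its [x] and [y]
   components. *)
have sum0 := symp0 ((- (X p).1.2, (X p).1.1), 0).
have sum0' : \sum_(i < n) (xcoord (X p) i ^+ 2 + ycoord (X p) i ^+ 2) = 0.
  by rewrite -[RHS]sum0; apply: eq_bigr => i _; rewrite /xcoord /ycoord/= !mxE; ring.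
have sq0 (i : 'I_n) : xcoord (X p) i ^+ 2 + ycoord (X p) i ^+ 2 = 0.
  move/eqP: sum0'; rewrite psumr_eq0 => [/allP/(_ i)|j _]; last first.
    by rewrite addr_ge0 ?sqr_ge0.
  by rewrite mem_index_enum => /(_ isT)/eqP.
have z0 : zcoord (X p) = 0.
  have := alphaX; rewrite alphaE sympC symp0 oppr0 mulr0 addr0 => ->.
  exact: (nbhs_singleton H0).
apply: coord_inj => [i|i|]; rewrite /xcoord /ycoord ?mxE//.
- by have /eqP := sq0 i; rewrite paddr_eq0 ?sqr_ge0// !sqrf_eq0 => /andP[/eqP].
- by have /eqP := sq0 i; rewrite paddr_eq0 ?sqr_ge0// !sqrf_eq0 => /andP[_ /eqP].
Qed.

Lemma eq_of_is_derive0_contact (c : R -> V) (a b : R) : a <= b ->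
  (forall x : R, a <= x <= b -> is_derive x (1 : R) c 0) -> c b = c a.
Proof.
move=> ab dc.
have coord (l : {linear V -> R}) : continuous l -> l (c b) = l (c a).
  move=> cl.
  have dl (x : R) : a <= x <= b -> is_derive x (1 : R) (l \o c) 0.
    move=> xab; have := dc x xab => dcx; rewrite -(linear0 l).
    exact: is_derive_linear_comp.
  apply: (@eq_of_is_derive0 _ (l \o c) a b ab).
    by move=> x /andP[ax xb]; apply: dl; rewrite !ltW.
  by apply: derivable_within_continuous => x; rewrite in_itv/= => xab; case: (dl x xab).
have X i := coord (xcoord_at i) (@xcoord_continuous _ _ i).
have Y i := coord (ycoord_at i) (@ycoord_continuous _ _ i).
exact: (coord_inj X Y (coord (@zcoord R n) zcoord_continuous)).
Qed.

(* Y need not come from a Lipschitz field, so there is no uniqueness of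
   trajectories to invoke; the rest points are propagated by connectedness. *)
Lemma stationary_curve (c Y : R -> V) (U : set V) : open U -> U (c 0) ->
  (forall t : R, 0 <= t <= 1 -> is_derive t (1 : R) c (Y t)) ->
  (forall t : R, 0 <= t <= 1 -> U (c t) -> Y t = 0) ->
  forall t : R, 0 <= t <= 1 -> c t = c 0.
Proof.
move=> oU Uc0 dc Y0.
pose A : set R := `[0, 1]%classic.
pose B : set R := A `&` [set t | c t = c 0].
have cc (t : R) : 0 <= t <= 1 -> {for t, continuous c}.
  by move=> t01; apply/differentiable_continuous/derivable1_diffP; case: (dc t t01).
(* While the curve stays in [U] its velocity vanishes, so [B] is open relative to [[0, 1]], where
   the derivative is known. *)
have locally_constant (t : R) : B t -> \forall s \near t, A s -> c s = c 0.
  rewrite /B /A /= in_itv/= => -[t01 ct].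
  have : \forall s \near t, U (c s).
    by apply: (cc t t01); rewrite /= ct; exact: open_nbhs_nbhs.
  move=> /nbhs_ballP[d /= d0 Hd]; near=> s => /=; rewrite in_itv/= => s01.
  have sd : ball t d s by near: s; exact: nbhsx_ballx.
  have key (a b : R) : a <= b -> 0 <= a -> b <= 1 -> ball t d a -> ball t d b -> c b = c a.
    move=> ab a0 b1 ta tb; apply: eq_of_is_derive0_contact => // x /andP[ax xb].
    have x01 : 0 <= x <= 1 by rewrite (le_trans a0)// (le_trans xb).
    have tx : ball t d x.
      move: ta tb; rewrite -!ball_normE/= !ltr_norml => /andP[? ?] /andP[? ?].
      by apply/andP; split; lra.
    by rewrite -(Y0 x x01 (Hd x tx)); exact: dc.
  have td : ball t d t by exact: ballxx.
  move: t01 s01 => /andP[t0 t1] /andP[s0 s1].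
  by have [st|/ltW ts] := leP s t; rewrite -ct; [apply/esym|]; exact: key.
have : B = A.
  apply: (@segment_connected R 0 1 B).
  - by exists 0; rewrite /B /A /= in_itv/= lexx ler01.
  - exists (interior [set s | A s -> c s = c 0]); first exact: open_interior.
    rewrite /B; apply/seteqP; split => s [As].
      by move=> cs; split => //; apply: locally_constant.
    by move=> /interior_subset/= /(_ As).
  (* [B] is closed in [A]: by continuity, [c s <> c 0] persists near [s]. *)
  - exists (~` interior [set s | A s -> c s <> c 0]).
      exact/open_closedC/open_interior.
    rewrite /B; apply/seteqP; split => s [As].
      by move=> cs; split => // /interior_subset/= /(_ As).
    move=> nI; split => //=; apply: contrapT => cs; apply: nI.
    have op : open (~` [set c 0]).
      by apply: closed_openC; apply: accessible_closed_set1; exact/hausdorff_accessible/norm_hausdorff.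
    have s01 : 0 <= s <= 1 by move: As; rewrite /A /= in_itv.
    have : \forall r \near s, (~` [set c 0]) (c r).
      by apply: (cc s s01); exact: open_nbhs_nbhs.
    by apply: filterS => r cr _.
move=> BA t t01.
have : A t by rewrite /A /= in_itv.
by rewrite -BA => -[].
Unshelve. all: by end_near. Qed.

Lemma flow_support H phi (K : set V) : contact_flow (fun _ => H) phi ->
  (forall q, differentiable H q) -> closed K -> (forall q, ~ K q -> H q = 0) ->
  isotopy_supported_in K phi.
Proof.
move=> [_ phi0 [X [XH dphi]]] dH cK H0 t p t01 Kp.
have oK : open (~` K) by exact: closed_openC.
rewrite -[RHS]phi0.
apply: (@stationary_curve (fun s => phi s p) (fun s => X s (phi s p)) (~` K)) => //.
- by rewrite phi0.
- move=> s s01 Ks; apply: (contact_field_eq0 (XH s s01)) => //.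
  have : nbhs (phi s p) (~` K) by exact: open_nbhs_nbhs.
  by apply: filterS => q; exact: H0.
Qed.

Lemma uniformly_cvgP (W : normedModType R) (F : nat -> R -> V -> W) (G : R -> V -> W) :
  uniformly_cvg F G <->
  forall e : R, 0 < e -> \forall i \near \oo, forall t p, 0 <= t <= 1 ->
    `|G t p - F i t p| < e.
Proof.
split.
- move=> FG e e0.
  have := FG [set f | forall q : R * V, time_space q -> ball (G q.1 q.2) e (f q)].
  case.
    apply/uniform_nbhs; exists [set xy | ball xy.1 e xy.2]; split => //.
    by rewrite -entourage_ballE; exists e.
  move=> N _ HN; exists N => // i /HN /= Hi t p t01.
  have := Hi (t, p); rewrite -ball_normE; apply; split => //=.
- move=> FG U /uniform_nbhs[E [entE EU]].
  move: entE; rewrite -entourage_ballE => -[e /= e0 eE].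
  apply: filterS (FG e e0) => i Hi.
  apply: EU => -[t p] [/= t01 _]; apply: eE; rewrite /= -ball_normE /=.
  by apply: Hi; move: t01; rewrite in_itv.
Qed.

(** For [p] in [K] this is Heine's theorem, from the near-covering form of compactness. Otherwise
    either [q] is in [K] and the roles are exchanged, or both values are zero. *)
Lemma compact_support_uniform_continuous (G : V -> R) (K : set V) :
  compact K -> continuous G -> (forall p, ~ K p -> G p = 0) ->
  forall e : R, 0 < e -> exists2 d : R, 0 < d &
    forall p q, `|p - q| < d -> `|G p - G q| < e.
Proof.
move=> cK cG G0 e e0.
have cov := (compact_near_coveringP K).1 cK.
pose P (d : R) (p : V) := forall q, `|p - q| < d -> `|G p - G q| < e.
have : \forall d \near 0^'+, K `<=` P d.
  apply: cov => x Kx.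
  have e20 : 0 < e / 2 by rewrite divr_gt0.
  have /cvgrPdist_lt/(_ _ e20)/nbhs_ballP[r /= r0 Hr] := cG x.
  have r20 : 0 < r / 2 by rewrite divr_gt0.
  have close q : `|x - q| < r -> `|G x - G q| < e / 2.
    by move=> xq; apply: Hr; rewrite -ball_normE.
  exists (ball x (r / 2), [set d | d < r / 2]) => /=.
    by split; [exact: nbhsx_ballx|exact: nbhs_right_lt].
  move=> [p d]; rewrite -ball_normE /= => -[xp dr] q pq.
  have xq : `|x - q| < r.
    rewrite -(subrK p x) -addrA (splitr r); apply: le_lt_trans (ler_normD _ _) _.
    by rewrite ltrD// (lt_trans pq).
  have := close q xq; have := close p _; rewrite (splitr r) ltr_wpDr// ?ltW// => /(_ isT).
  have -> : G p - G q = (G x - G q) - (G x - G p) by ring.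
  by move=> Gp Gq; rewrite (splitr e); apply: le_lt_trans (ler_normB _ _) (ltrD Gq Gp).
move=> near_d; have [d [d0 Hd]] := filter_ex (filterI (nbhs_right_gt 0) near_d).
exists d => // p q pq; have [Kp|nKp] := pselect (K p); first exact: Hd.
have [Kq|nKq] := pselect (K q); last by rewrite !G0// subrr normr0.
by rewrite distrC; apply: Hd => //; rewrite distrC.
Qed.

End ContactFlows.

(** * Profile Hamiltonians *)

Section ProfileHamiltonians.
Context {R : realType} {n : nat}.
Local Notation V := (contact_space R n).
Local Notation mu := (@lebesgue_measure R).

Lemma rad_ge0 (p : V) : 0 <= Defs.rad p.
Proof. exact: sqrtr_ge0. Qed.

Lemma continuous_sum (T : topologicalType) (m : nat) (f : 'I_m -> T -> R) :
  (forall i, continuous (f i)) -> continuous (fun x => \sum_(i < m) f i x).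
Proof.
elim: m f => [|m IH] f cf.
  rewrite (_ : (fun x => _) = cst 0); last by apply/funext => x; rewrite big_ord0.
  by move=> x; exact: cvg_cst.
rewrite (_ : (fun x => _) =
    fun x => \sum_(i < m) f (widen_ord (leqnSn m) i) x + f ord_max x); last first.
  by apply/funext => x; rewrite big_ord_recr.
by move=> x; apply: cvgD; [apply: IH => i; exact: cf|exact: cf].
Qed.

Lemma rad_continuous : continuous (@Defs.rad R n).
Proof.
have cS : continuous (fun q : V => \sum_(i < n) (xcoord q i ^+ 2 + ycoord q i ^+ 2)).
  apply: continuous_sum => i q.
  have cx := @xcoord_continuous R n i q; have cy := @ycoord_continuous R n i q.
  by apply: cvgD; under eq_fun do rewrite expr2; exact: cvgM.
by move=> p; apply: (continuous_comp (cS p)); exact: sqrt_continuous.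
Qed.

Lemma coord_le_rad (p : V) (i : 'I_n) :
  (`|xcoord p i| <= Defs.rad p) && (`|ycoord p i| <= Defs.rad p).
Proof.
have le_sum : xcoord p i ^+ 2 + ycoord p i ^+ 2 <=
    \sum_(j < n) (xcoord p j ^+ 2 + ycoord p j ^+ 2).
  rewrite (bigD1 i)//= lerDl sumr_ge0// => j _.
  by rewrite addr_ge0 ?sqr_ge0.
by rewrite -!sqrtr_sqr !ler_sqrt ?(le_trans _ le_sum) ?lerDl ?lerDr ?addr_ge0 ?sqr_ge0.
Qed.

(** The [z]-derivative of [profile_ham] and the integrand of [profile_conf], given by a formula that
    also makes sense for the singular profile. *)
Definition profile_dz (eta rho : R -> R) (p : V) : R :=
  derive1 eta (zcoord p) * tail_int rho (Defs.rad p).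

Lemma derive_ez_profile_ham (eta rho : R -> R) (p : V) :
  derivable eta (zcoord p) 1 ->
  'D_e_z (profile_ham eta rho) p = profile_dz eta rho p.
Proof.
move=> deta; rewrite /profile_dz derive1E /derive.
have E : (fun h : R => h^-1 *: (profile_ham eta rho (h *: e_z + p) - profile_ham eta rho p))
  = (fun h : R => h^-1 *: (eta (h *: (1 : R) + zcoord p) - eta (zcoord p)) * tail_int rho (Defs.rad p)).
  apply/funext => h; rewrite /profile_ham.
  have -> : Defs.rad (h *: e_z + p) = Defs.rad p.
    congr Num.sqrt; apply: eq_bigr => i _.
    by rewrite /xcoord /ycoord/= !mxE mulr0 !add0r.
  by rewrite /GRing.scale/= -mulrBl mulrA.
rewrite /= E; apply/cvg_lim => //.
by apply: cvgM; [exact: deta|exact: cvg_cst].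
Qed.

(** The bound 1 in [x] and [y] reflects that the tails vanish for [rad >= 1]; [B] is meant to bound
    the support of [eta]. *)
Definition box (B : R) : set V :=
  ([set x : 'rV[R]_n | forall i, `[-1, 1]%classic (x ord0 i)] `*`
   [set y : 'rV[R]_n | forall i, `[-1, 1]%classic (y ord0 i)]) `*` `[- B, B]%classic.

Lemma box_compact (B : R) : compact (box B).
Proof.
apply: compact_setX; last exact: segment_compact.
have cube := @rV_compact R n (fun=> `[-1, 1]%classic) (fun=> @segment_compact _ _ _).
exact: compact_setX.
Qed.

Lemma outside_box (B : R) (p : V) : ~ box B p -> B < `|zcoord p| \/ 1 <= Defs.rad p.
Proof.
move=> nbox; apply: contrapT => /not_orP[/negP + /negP].
rewrite -leNgt -ltNge => zB /ltW r1; apply: nbox.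
split; [split|] => [i|i|]; rewrite /= in_itv/= -ler_norml//.
- by have /andP[+ _] := coord_le_rad p i; move/le_trans; apply.
- by have /andP[_] := coord_le_rad p i; move/le_trans; apply.
Qed.

(** Regards an autonomous function as one of time and space; its derivative along [v] sees only
    [v.2]. *)
Lemma Ck_on_snd (W : normedModType R) (f : V -> W) (k : nat) :
  Ck_on setT k f -> Ck_on setT k (fun q : R * V => f q.2).
Proof.
elim: k f => [|k IH] f /=.
  by move=> cf q _; apply: continuous_comp; [exact: cvg_snd|exact: cf].
move=> [df sf]; split=> [q _|v].
  apply: (@differentiable_comp _ _ _ _ snd f); last exact: df.
  by apply: linear_differentiable => y; exact: cvg_snd.
rewrite (_ : (fun x => _) = fun q : R * V => 'D_(v.2) f q.2); first exact: (IH (fun y => 'D_(v.2) f y) (sf v.2)).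
by apply/funext => q.
Qed.

(** * Regularity, bounds and supports coming from the cut-off *)

Section Cutoff.
Variables (eta : R -> R) (B : R).
Hypothesis (eta_smooth : smooth_on setT eta).
Hypothesis (eta_supp : forall z : R, B < `|z| -> eta z = 0).

Lemma derive1_cutoff_continuous : continuous (derive1 eta).
Proof.
have E : derive1 eta = (fun z => 'D_1 eta z) by apply/funext => z; rewrite derive1E.
by move=> z; rewrite E; exact: ((eta_smooth 1).2 1 z I).
Qed.

Lemma derive1_cutoff_eq0 (z : R) : B < `|z| -> derive1 eta z = 0.
Proof.
move=> Bz; rewrite derive1E (@near_eq_derive _ _ _ eta (cst 0)); first exact: derive_cst.
have /cvgrPdist_lt/(_ (`|z| - B)) := @norm_continuous _ R z.
rewrite subr_gt0 => /(_ Bz); apply: filterS => y; rewrite ltr_norml => /andP[_ yz].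
by apply: eta_supp; lra.
Qed.

(** The extreme value theorem gives the bound on a segment outside of which the derivative is zero.
    The absolute value of [B] covers negative [B], and adding 1 makes [M] positive for a later
    division. *)
Lemma derive1_cutoff_bounded : exists M : R, 0 < M /\ forall z : R, `|derive1 eta z| <= M.
Proof.
have B0 : - `|B| <= `|B| by rewrite ge0_cp.
have cn : {within `[- `|B|, `|B|], continuous (fun z => `|derive1 eta z|)}.
  apply: continuous_subspaceT => z; apply: cvg_norm; exact: derive1_cutoff_continuous.
have [c _ Hc] := EVT_max B0 cn.
exists (`|derive1 eta c| + 1); split; first by rewrite ltr_wpDl.
move=> z; have [zB|zB] := leP `|z| `|B|.
  by rewrite (le_trans (Hc z _)) ?lerDl// in_itv/= -ler_norml.
by rewrite derive1_cutoff_eq0 ?normr0 ?addr_ge0// (le_lt_trans (ler_norm B)).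
Qed.

Lemma profile_dz_continuous (rho : R -> R) : integrable_profile rho ->
  continuous (profile_dz eta rho).
Proof.
move=> irho p; apply: cvgM.
  by apply: continuous_comp; [exact: zcoord_continuous|exact: derive1_cutoff_continuous].
exact: (tail_int_comp_continuous irho rad_continuous rad_ge0).
Qed.

Lemma profile_ham_outside_box (rho : R -> R) (p : V) : ~ box B p ->
  profile_ham eta rho p = 0.
Proof.
by rewrite /profile_ham => /outside_box[/eta_supp->|/tail_int_ge1->];
  rewrite ?mul0r ?mulr0.
Qed.

Lemma profile_dz_outside_box (rho : R -> R) (p : V) : ~ box B p ->
  profile_dz eta rho p = 0.
Proof.
by rewrite /profile_dz => /outside_box[/derive1_cutoff_eq0->|/tail_int_ge1->];
  rewrite ?mul0r ?mulr0.
Qed.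

End Cutoff.

Lemma profile_confE (eta rho : R -> R) (phi : R -> V -> V) (t : R) (p : V) :
  profile_conf eta rho phi t p = \int[mu]_(s in `[0, t]) profile_dz eta rho (phi s p).
Proof. by []. Qed.

(** As the interval has length [t <= 1], a pointwise bound passes to the integrals with the same
    constant. *)
Lemma Rintegral_dist (f g : R -> R) (t e : R) : 0 <= t <= 1 -> 0 <= e ->
  {within `[0, t], continuous f} -> {within `[0, t], continuous g} ->
  (forall s : R, 0 <= s <= t -> `|f s - g s| <= e) ->
  `|\int[mu]_(s in `[0, t]) f s - \int[mu]_(s in `[0, t]) g s| <= e.
Proof.
move=> /andP[t0 t1] e0 cf cg fg.
have ct : compact (`[0, t]%classic : set R) by exact: segment_compact.
have mt : measurable (`[0, t]%classic : set (measurableTypeR R)) by [].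
have ifn : mu.-integrable `[0, t] (EFin \o f) by exact: continuous_compact_integrable.
have ign : mu.-integrable `[0, t] (EFin \o g) by exact: continuous_compact_integrable.
have cfg : {within `[0, t], continuous (fun s => f s - g s)}.
  by move=> s; apply: cvgB; [exact: cf|exact: cg].
have ifg : mu.-integrable `[0, t] (EFin \o (fun s => f s - g s)).
  exact: continuous_compact_integrable.
rewrite -RintegralB//; apply: le_trans (le_normr_Rintegral mt ifg) _.
apply: (@le_trans _ _ (\int[mu]_(s in `[0, t]) e)).
  apply: le_Rintegral => //.
  - apply: continuous_compact_integrable => // s; apply: cvg_norm; exact: cfg.
  - apply: continuous_compact_integrable => //.
    by apply: continuous_subspaceT => s; exact: cvg_cst.
have mut : fine (mu `[0, t]%classic) = t.
  rewrite lebesgue_measure_itv/= lte_fin; case: ltgtP t0 => // _ _.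
  by rewrite /= oppr0 addr0.
by rewrite Rintegral_cst// mut ler_piMr.
Qed.

(** The limit isotopy is continuous relative to [time_space], so its paths are obtained as
    continuous within the time interval. *)
Lemma isotopy_path_continuous (phi : R -> V -> V) (t : R) (p : V) : t <= 1 ->
  {within time_space, continuous (fun q : (R * V)%type => phi q.1 q.2)} ->
  {within `[0, t], continuous (fun s => phi s p)}.
Proof.
move=> t1 /subspace_continuousP cphi; apply/subspace_continuousP => s.
rewrite /= in_itv/= => /andP[s0 st] U /= Us.
have ts : time_space (s, p) by split => //=; rewrite in_itv/= s0 (le_trans st).
have := cphi (s, p) ts U Us; rewrite /within/= => -[[A B'] /= [As Bp] AB].
rewrite /nbhs/=; apply: filterS As => r Ar; rewrite in_itv/= => /andP[r0 rt].
apply: (AB (r, p)); first by split => //=; exact: nbhs_singleton.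
by split => //=; rewrite in_itv/= r0 (le_trans rt).
Qed.

End ProfileHamiltonians.

(** * Convergence of Hamiltonians in the integrated norm and of conformal factors *)

Section Convergence.
Context {R : realType} {n : nat}.
Local Notation V := (contact_space R n).
Local Notation mu := (@lebesgue_measure R).

(** The sup distance is constant in [t] and [[0, 1]] has measure 1, so the integral equals that
    distance. *)
Lemma autonomous_L1_sup_cvg (Hs : nat -> V -> R) (H : V -> R) :
  uniformly_cvg (fun j _ => Hs j) (fun _ => H) ->
  L1_sup_cvg (fun j _ => Hs j) (fun _ : R => H).
Proof.
move=> /uniformly_cvgP HsH.
pose c j : \bar R := sup_norm (fun p => H p - Hs j p).
split=> [j|]; first exact: (measurable_cst (c j)).
have intE j : (\int[mu]_(t in `[0%R, 1%R]) sup_dist (fun=> H) (fun=> Hs j) t)%E = c j.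
  have mu01 : mu `[0, 1]%classic = 1%E.
    by rewrite lebesgue_measure_itv/= lte_fin ltr01 oppr0 adde0.
  by rewrite (integral_cst mu _ (c j))//= [X in (_ * X)%E]mu01 mule1.
under eq_fun do rewrite intE.
have c_ge0 j : (0 <= c j)%E.
  by apply: (@le_trans _ _ (`|H 0 - Hs j 0|)%:E); [rewrite lee_fin|apply: ereal_sup_ubound; exists 0].
have c_le (e : R) : 0 < e -> \forall j \near \oo, (c j <= e%:E)%E.
  move=> e0; apply: filterS (HsH e e0) => j Hj.
  apply: ge_ereal_sup => _ [p _ <-]; rewrite lee_fin ltW//.
  by apply: (Hj 0); rewrite lexx ler01.
(* The distances are extended reals: they are eventually finite, by the bound 1, and their real
   values tend to 0. *)
apply/fine_cvgP; split.
  apply: filterS (c_le 1 ltr01) => j cj1; rewrite ge0_fin_numE//.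
  exact: le_lt_trans cj1 (ltry _).
apply/cvgrPdist_le => e e0; apply: filterS (c_le e e0) => j cje.
rewrite sub0r normrN /= ger0_norm ?fine_ge0//.
rewrite -lee_fin fineK// ge0_fin_numE//.
exact: le_lt_trans cje (ltry _).
Qed.

Variables (eta : R -> R) (B : R).
Hypothesis (eta_smooth : smooth_on setT eta).
Hypothesis (eta_supp : forall z : R, B < `|z| -> eta z = 0).

Lemma profile_conf_eq0 (rho : R -> R) (K : set V) (phi : R -> V -> V) :
  box B `<=` K -> isotopy_supported_in K phi ->
  forall (t : R) (p : V), 0 <= t <= 1 -> ~ K p -> profile_conf eta rho phi t p = 0.
Proof.
move=> BK sphi t p /andP[t0 t1] Kp.
rewrite profile_confE (@eq_Rintegral _ _ _ _ _ (fun=> 0)).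
  by rewrite Rintegral_cst// mul0r.
move=> s; rewrite inE/= in_itv/= => /andP[s0 st].
rewrite sphi//; last by rewrite s0 (le_trans st).
by apply: (profile_dz_outside_box eta_supp) => /BK.
Qed.

(** The integrands are compared through [profile_dz eta rho (phis j s p)]: uniform continuity of
    [profile_dz eta rho] absorbs the change of isotopy, the bound on [derive1 eta] and the
    convergence of tails absorb the change of profile. *)
Lemma profile_conf_cvg (rho : R -> R) (rhos : nat -> R -> R)
    (phis : nat -> R -> V -> V) (phi : R -> V -> V) :
  integrable_profile rho -> (forall j, integrable_profile (rhos j)) ->
  (forall e : R, 0 < e -> \forall j \near \oo, forall r : R, 0 <= r ->
    `|tail_int rho r - tail_int (rhos j) r| < e) ->
  (forall j, {within time_space, continuous (fun q : (R * V)%type => phis j q.1 q.2)}) ->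
  {within time_space, continuous (fun q : (R * V)%type => phi q.1 q.2)} ->
  uniformly_cvg phis phi ->
  uniformly_cvg (fun j => profile_conf eta (rhos j) (phis j)) (profile_conf eta rho phi).
Proof.
move=> irho irhos tail_cvg cphis cphi /uniformly_cvgP phis_cvg.
apply/uniformly_cvgP => e e0.
have [M [M0 etaM]] := derive1_cutoff_bounded eta_smooth eta_supp.
have e40 : 0 < e / 4 by rewrite divr_gt0.
have cG := @profile_dz_continuous R n _ eta_smooth _ irho.
have G0 := @profile_dz_outside_box R n _ _ eta_supp rho.
have [d d0 Gd] := compact_support_uniform_continuous (@box_compact R n B) cG G0 e40.
have eM0 : 0 < e / 4 / M by rewrite divr_gt0.
apply: filterS2 (phis_cvg d d0) (tail_cvg _ eM0) => j phisj tailj t p t01.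
rewrite !profile_confE.
(* Two errors of [e / 4] leave room for the strict inequality, as the integral estimate is not
   strict. *)
apply: (@le_lt_trans _ _ (e / 4 + e / 4)); last lra.
have [t0 t1] := andP t01.
apply: Rintegral_dist => //; first lra.
- have cp := isotopy_path_continuous (p := p) t1 cphi.
  by move=> s; exact: (continuous_comp (cp s) (cG _)).
- have cp := isotopy_path_continuous (p := p) t1 (cphis j).
  have cGj := @profile_dz_continuous R n _ eta_smooth _ (irhos j).
  by move=> s; exact: (continuous_comp (cp s) (cGj _)).
move=> s /andP[s0 st]; have s01 : 0 <= s <= 1 by rewrite s0 (le_trans st).
set q := phi s p; set q' := phis j s p.
have close1 : `|profile_dz eta rho q - profile_dz eta rho q'| < e / 4.
  by apply: Gd; exact: phisj.
have close2 : `|profile_dz eta rho q' - profile_dz eta (rhos j) q'| <= e / 4.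
  rewrite /profile_dz -mulrBr normrM.
  rewrite -[leRHS](divfK (lt0r_neq0 M0)) mulrC ler_pM// ltW//.
  exact/tailj/rad_ge0.
rewrite -(subrK (profile_dz eta rho q') (profile_dz eta rho q)) -addrA.
by apply: le_trans (ler_normD _ _) _; rewrite lerD// ltW.
Qed.

End Convergence.

Unset Implicit Arguments.
Set Strict Implicit.
Set Printing Implicit Defensive.


Theorem corollary11p10
  (R : realType) (n : nat) (n_gt0 : (0 < n)%N)
  (a : R) (a_itv : 0 < a < 2)
  (rho : R -> R) (rhoP : singular_profile a rho)
  (eta : R -> R) (etaP : cutoff eta)
  (eta_rho : compatible eta rho)
  (eps : nat -> R) (rhos : nat -> R -> R)
  (rhosP : profile_approx rho eps rhos)
  (Hs_smooth : forall j,
     smooth_on setT (profile_ham eta (rhos j) : contact_space R n -> R))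
  (phis : nat -> R -> contact_space R n -> contact_space R n)
  (phisP : forall j, contact_flow (fun _ => profile_ham eta (rhos j)) (phis j))
  (phi : R -> contact_space R n -> contact_space R n)
  (phi_isotopy : continuous_isotopy phi)
  (phi_supp : exists2 K, compact K & isotopy_supported_in K phi)
  (phis_cvg : uniformly_cvg phis phi) :
  let H := fun _ : R => profile_ham eta rho in
  let h := profile_conf eta rho phi in
  [/\ continuous_contact_ds phi H h,
      topological_contact_ds phi H h &
      contact_homeomorphism (phi 1)].
Proof.
move=> H h.
have /andP[_ a2] := a_itv.
have [eta_smooth eta01 [B etaB] _] := etaP.
have irho := singular_integrable_profile a2 rhoP.
have irhos j : integrable_profile (rhos j).
  by apply: smooth_integrable_profile; case: rhosP.
have tail_cvg := approx_tail_int_cvg a2 rhoP rhosP.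
have [K1 cK1 phiK1] := phi_supp.
(* The approximating flows are supported in the box and the limit isotopy in [K1]; the union serves
   both. *)
pose K := box B `|` K1.
have boxK : box B `<=` K by exact: subsetUl.
have sK phi' (K' : set (contact_space R n)) : K' `<=` K -> isotopy_supported_in K' phi' ->
    isotopy_supported_in K phi'.
  by move=> K'K phiK' t p t01 nKp; apply: phiK' => // /K'K.
have phiK : isotopy_supported_in K phi by apply: sK phiK1; exact: subsetUr.
pose Hs j := fun _ : R => (profile_ham eta (rhos j) : contact_space R n -> R).
pose hs j := profile_conf eta (rhos j) (phis j).
have dHs j q : differentiable (Hs j 0) q by exact: (Hs_smooth j 1).1.
have phisK j : isotopy_supported_in K (phis j).
  apply: (sK _ (box B)) => //; apply: (flow_support (phisP j) (dHs j)).
    by apply: compact_closed; [exact: norm_hausdorff|exact: box_compact].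
  by move=> q; exact: profile_ham_outside_box.
have dez j : (fun q => 'D_e_z (Hs j 0) q) = profile_dz eta (rhos j).
  apply/funext => q; apply: derive_ez_profile_ham.
  exact/diff_derivable/((eta_smooth 1).1 _ I).
have smooth_ds j : smooth_contact_ds (phis j) (Hs j) (hs j).
  split; [by move=> k; apply: Ck_on_snd; exact: Hs_smooth | exact: phisP | ].
  (* By [dez] the conformal factor obtained from the flow is the explicit [hs j]. *)
  have <- : (fun t p => \int[@lebesgue_measure R]_(s in `[0, t])
      'D_e_z (Hs j 0) (phis j s p)) = hs j.
    apply/funext => t; apply/funext => p; apply: eq_Rintegral => s _.
    exact: (congr1 (fun f => f (phis j s p)) (dez j)).
  apply: (flow_conformal_factor (phisP j) (dHs j)).
  by rewrite dez; exact: profile_dz_continuous.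
(* Stated for any profile and isotopy, to cover the limit triple and the approximating ones. *)
have supp rho' phi' : isotopy_supported_in K phi' ->
    supported_in K phi' (fun _ => profile_ham eta rho') (profile_conf eta rho' phi').
  move=> phi'K; split => // t p t01 nKp; split.
    by apply: (profile_ham_outside_box etaB) => /boxK.
  exact: (profile_conf_eq0 etaB rho' boxK phi'K).
have cK : compact K by apply: compactU => //; exact: box_compact.
have Hs_cvg : uniformly_cvg Hs H.
  apply/uniformly_cvgP => e e0; apply: filterS (tail_cvg e e0) => j tailj t p _.
  rewrite /H /Hs /profile_ham -mulrBr normrM.
  have /andP[eta0 eta1] := eta01 (zcoord p).
  rewrite ger0_norm//; apply: le_lt_trans (tailj _ (rad_ge0 p)).
  by rewrite ler_piMl.
have hs_cvg : uniformly_cvg hs h.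
  apply: (profile_conf_cvg eta_smooth etaB) => // [j|].
    apply: continuous_subspaceT => q.
    by have [sphi _ _] := phisP j; exact: (sphi 0).
  by case: phi_isotopy.
have top : topological_contact_ds phi H h.
  split => //; exists K, phis, Hs, hs; split => //.
  - exact: supp.
  - by move=> j; split => //; exact: supp.
  - by split => //; exact: autonomous_L1_sup_cvg.
split => //.
  split => //; exists K, phis, Hs, hs; split => //.
  - exact: supp.
  - by move=> j; split => //; exact: supp.
by exists phi, H, h.
Qed.
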